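(* Let $\Gamma$ be a finitely generated group. There is a natural isomorphism \[ X(\Gamma,\mathrm{SL}_2(\mathbb{C}))/\!/H^1(\Gamma,C_2)\cong\overline{X}(\Gamma). \]
   Context: $R(\Gamma)=\mathrm{Hom}(\Gamma,\mathrm{PSL}_2(\mathbb{C}))$ and $R(\Gamma,\mathrm{SL}_2(\mathbb{C}))=\mathrm{Hom}(\Gamma,\mathrm{SL}_2(\mathbb{C}))$ are affine algebraic sets (via the images of a finite generating set; $\mathrm{PSL}_2(\mathbb{C})\cong \mathrm{SO}_3(\mathbb{C})$ is affine). For a reductive group $G$ acting algebraically on an affine algebraic set $Z$, $Z/\!/G$ denotes the affine algebraic set with $\mathbb{C}[Z/\!/G]\cong\mathbb{C}[Z]^G$. $X(\Gamma,\mathrm{SL}_2(\mathbb{C}))=R(\Gamma,\mathrm{SL}_2(\mathbb{C}))/\!/\mathrm{SL}_2(\mathbb{C})$ (conjugation action). $\overline{R}(\Gamma)\subset R(\Gamma)$ is the set of representations that lift to $\mathrm{SL}_2(\mathbb{C})$; it is a union of connected components of $R(\Gamma)$ (a theorem of Culler), hence Zariski closed, and it is invariant under conjugation; $\overline{X}(\Gamma)=\overline{R}(\Gamma)/\!/\mathrm{PSL}_2(\mathbb{C})$. $C_2=\{\pm1\}$ and $H^1(\Gamma,C_2)=\mathrm{Hom}(\Gamma,C_2)$ is a finite group acting on $R(\Gamma,\mathrm{SL}_2(\mathbb{C}))$ by $(\epsilon\cdot\rho)(\gamma)=\epsilon(\gamma)\rho(\gamma)$, which induces an action on $X(\Gamma,\mathrm{SL}_2(\mathbb{C}))$.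 ''Natural'' means induced by composing representations with the projection $\mathrm{SL}_2(\mathbb{C})\to \mathrm{PSL}_2(\mathbb{C})$; the isomorphism is one of affine algebraic sets. *)

(* Defs.v *)
From HB Require Import structures.
From mathcomp Require Import all_boot all_order all_algebra generic_quotient.
From mathcomp Require Import reals.
From mathcomp Require Import complex.
From mathcomp.multinomials Require Import mpoly.

Set Implicit Arguments.
Unset Strict Implicit.
Unset Printing Implicit Defensive.

Import Order.TTheory GRing.Theory Num.Theory.

Local Open Scope ring_scope.
Local Open Scope quotient_scope.
Local Open Scope complex_scope.

(** * Affine algebraic sets *)

(** A set with a distinguished family of complex-valued functions.  An affine
    algebraic set is such a space satisfying [affine] below; [regular] is then
    its coordinate ring. *)
Record fspace (R : realType) := FSpace {
  point :> Type;
  regular : (point -> R[i]) -> Prop }.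

Section AffineSets.
Variable R : realType.
Local Notation C := R[i].

(** Polynomials in the coordinates of C^I, for a finite index set I. *)
Definition peval (I : finType) (p : {mpoly C[#|I|]}) (z : I -> C) : C :=
  p.@[fun j => z (enum_val j)].

Definition zariski_closed (I : finType) (V : (I -> C) -> Prop) : Prop :=
  exists S : {mpoly C[#|I|]} -> Prop,
    forall z, V z <-> forall p, S p -> peval p z = 0.

Definition polynomial_in (T : Type) (I : finType) (c : T -> I -> C)
    (u : T -> C) : Prop :=
  exists p : {mpoly C[#|I|]}, forall x, u x = peval p (c x).

(** X is isomorphic to a Zariski closed subset of some C^I, with the
    restrictions of polynomials as regular functions. *)
Definition affine (X : fspace R) : Prop :=
  exists (I : finType) (e : X -> I -> C),
    [/\ forall x y, e x =1 e y -> x = y,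
        zariski_closed (fun z => exists x, e x =1 z)
      & forall u, regular u <-> polynomial_in e u].

Definition regular_map (X Y : fspace R) (f : X -> Y) : Prop :=
  forall u : Y -> C, regular u -> regular (fun x => u (f x)).

Definition isomorphism (X Y : fspace R) (f : X -> Y) : Prop :=
  exists h : Y -> X,
    [/\ cancel f h, cancel h f, regular_map f & regular_map h].

Definition subspace (Z : fspace R) (P : Z -> Prop) : fspace R :=
  FSpace (fun u : {z : Z | P z} -> C =>
    exists2 v : Z -> C, regular v & forall z, u z = v (sval z)).

(** * Quotients *)

Definition invariant (G : Type) (Z : fspace R) (act : G -> Z -> Z)
    (u : Z -> C) : Prop :=
  forall a z, u (act a z) = u z.

(** [p : Z -> Q] exhibits Q as Z//G: Q is an affine algebraic set and
    composition with p is an isomorphism from C[Q] onto C[Z]^G. *)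
Definition is_quotient (G : Type) (Z : fspace R) (act : G -> Z -> Z)
    (Q : fspace R) (p : Z -> Q) : Prop :=
  [/\ affine Q,
      forall u : Q -> C, regular u ->
        regular (fun z => u (p z)) /\ invariant act (fun z => u (p z)),
      forall u v : Q -> C, regular u -> regular v ->
        (forall z, u (p z) = v (p z)) -> u =1 v
    & forall w : Z -> C, regular w -> invariant act w ->
        exists2 u : Q -> C, regular u & forall z, w z = u (p z)].

(** [beta] is the algebraic action on Q induced through p by the action [act]
    on Z.  When p is a quotient map, each [beta a] is determined by this. *)
Definition induced_action (G : Type) (Z Q : fspace R) (act : G -> Z -> Z)
    (p : Z -> Q) (beta : G -> Q -> Q) : Prop :=
  (forall a, regular_map (beta a)) /\
  (forall a z, beta a (p z) = p (act a z)).

End AffineSets.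

(** * Groups *)

Definition generates (Gamma : groupType) (n : nat) (g : 'I_n -> Gamma) : Prop :=
  forall P : Gamma -> Prop,
    P 1%g -> (forall x y, P x -> P y -> P (x * y)%g) ->
    (forall x, P x -> P x^-1%g) -> (forall i, P (g i)) ->
    forall x, P x.

(** C_2 as the group of integers {1, -1}. *)
Definition C2 : Type := {x : int | (x == 1) || (x == -1)}.

HB.instance Definition _ := [isSub of C2 for sval].
HB.instance Definition _ := [Choice of C2 by <:].

Section C2Group.

Fact c2_mul_subproof (x y : C2) : (val x * val y == 1) || (val x * val y == -1).
Proof. by case: x y => x /= /orP[]/eqP-> [y /= /orP[]/eqP->]. Qed.

Definition c2_mul (x y : C2) : C2 := Sub (val x * val y) (c2_mul_subproof x y).
Definition c2_one : C2 := Sub (1 : int) isT.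

Fact c2_mulA : associative c2_mul.
Proof. by move=> x y z; apply: val_inj; rewrite /= mulrA. Qed.
Fact c2_mul1g : left_id c2_one c2_mul.
Proof. by move=> x; apply: val_inj; rewrite /= mul1r. Qed.
Fact c2_mulg1 : right_id c2_one c2_mul.
Proof. by move=> x; apply: val_inj; rewrite /= mulr1. Qed.
Fact c2_mulgg (x : C2) : c2_mul x x = c2_one.
Proof. by apply: val_inj; case: x => x /= /orP[]/eqP->. Qed.

HB.instance Definition _ := isGroup.Build C2
  c2_mulA c2_mul1g c2_mulg1 (c2_mulgg : left_inverse c2_one id c2_mul)
  (c2_mulgg : right_inverse c2_one id c2_mul).

End C2Group.

Section SL2.
Variable R : realType.
Local Notation C := R[i].

Definition SL2 : Type := {A : 'M[C]_2 | \det A == 1}.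

HB.instance Definition _ := [isSub of SL2 for sval].
HB.instance Definition _ := [Choice of SL2 by <:].

Lemma SL2_det (A : SL2) : \det (val A) = 1.
Proof. exact/eqP/(valP A). Qed.

Lemma SL2_unit (A : SL2) : val A \in unitmx.
Proof. by rewrite unitmxE SL2_det unitr1. Qed.

Fact sl2_mul_subproof (A B : SL2) : \det (val A *m val B) == 1.
Proof. by rewrite det_mulmx !SL2_det mulr1. Qed.
Fact sl2_one_subproof : \det (1%:M : 'M[C]_2) == 1.
Proof. by rewrite det1. Qed.
Fact sl2_inv_subproof (A : SL2) : \det (invmx (val A)) == 1.
Proof. by rewrite det_inv SL2_det invr1. Qed.

Definition sl2_mul (A B : SL2) : SL2 := exist _ (val A *m val B) (sl2_mul_subproof A B).
Definition sl2_one : SL2 := exist _ 1%:M sl2_one_subproof.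
Definition sl2_inv (A : SL2) : SL2 := exist _ (invmx (val A)) (sl2_inv_subproof A).

Fact sl2_mulA : associative sl2_mul.
Proof. by move=> A B D; apply: val_inj; rewrite /= mulmxA. Qed.
Fact sl2_mul1g : left_id sl2_one sl2_mul.
Proof. by move=> A; apply: val_inj; rewrite /= mul1mx. Qed.
Fact sl2_mulg1 : right_id sl2_one sl2_mul.
Proof. by move=> A; apply: val_inj; rewrite /= mulmx1. Qed.
Fact sl2_mulVg : left_inverse sl2_one sl2_inv sl2_mul.
Proof. by move=> A; apply: val_inj; rewrite /= mulVmx ?SL2_unit. Qed.
Fact sl2_mulgV : right_inverse sl2_one sl2_inv sl2_mul.
Proof. by move=> A; apply: val_inj; rewrite /= mulmxV ?SL2_unit. Qed.

HB.instance Definition _ := isGroup.Build SL2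
  sl2_mulA sl2_mul1g sl2_mulg1 sl2_mulVg sl2_mulgV.

Lemma val_sl2M (A B : SL2) : val (A * B)%g = val A *m val B.
Proof. by []. Qed.
Lemma val_sl2V (A : SL2) : val (A^-1)%g = invmx (val A).
Proof. by []. Qed.

Fact sl2_scale_subproof (s : C2) (A : SL2) : \det ((val s)%:~R *: val A) == 1.
Proof.
rewrite detZ SL2_det mulr1.
by case: s => s /= /orP[]/eqP->; rewrite ?rmorphN rmorph1 ?sqrrN expr1n.
Qed.

Definition sl2_scale (s : C2) (A : SL2) : SL2 := 
  exist _ ((val s)%:~R *: val A) (sl2_scale_subproof s A).

Lemma sl2_scaleM (s t : C2) (A B : SL2) :
  sl2_scale (s * t)%g (A * B)%g = (sl2_scale s A * sl2_scale t B)%g.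
Proof.
apply: val_inj; rewrite /= -scalemxAl -scalemxAr scalerA.
by rewrite /= rmorphM.
Qed.

(** * PSL_2(C) = SL_2(C)/{±1} *)

Definition sl2_equiv (A B : SL2) : bool :=
  (val A == val B) || (val A == - val B).

Fact sl2_equiv_refl : reflexive sl2_equiv.
Proof. by move=> A; rewrite /sl2_equiv eqxx. Qed.
Fact sl2_equiv_sym : ssrbool.symmetric sl2_equiv.
Proof.
move=> A B; rewrite /sl2_equiv eq_sym; congr (_ || _).
by rewrite -eqr_oppLR eq_sym.
Qed.
Fact sl2_equiv_trans : transitive sl2_equiv.
Proof.
move=> B A D; rewrite /sl2_equiv => /orP[]/eqP-> /orP[]/eqP->.
- by rewrite eqxx.
- by rewrite eqxx orbT.
- by rewrite eqxx orbT.
- by rewrite opprK eqxx.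
Qed.

Canonical sl2_equiv_rel :=
  EquivRel sl2_equiv sl2_equiv_refl sl2_equiv_sym sl2_equiv_trans.

Definition PSL2 : Type := {eq_quot sl2_equiv}.
HB.instance Definition _ := Choice.on PSL2.
HB.instance Definition _ := EqQuotient.on PSL2.

Definition psl2_proj (A : SL2) : PSL2 := \pi_PSL2 A.

Lemma psl2_projP (A B : SL2) :
  reflect (val A = val B \/ val A = - val B) (psl2_proj A == psl2_proj B).
Proof.
apply: (iffP idP) => [|h].
  by rewrite /psl2_proj eqmodE => /orP[]/eqP; [left | right].
by rewrite /psl2_proj eqmodE /= /sl2_equiv; case: h => ->; rewrite eqxx ?orbT.
Qed.

Lemma psl2_projK (x : PSL2) : psl2_proj (repr x) = x.
Proof. exact: reprK. Qed.

Definition psl2_mul (x y : PSL2) : PSL2 := psl2_proj (repr x * repr y)%g.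
Definition psl2_one : PSL2 := psl2_proj 1%g.
Definition psl2_inv (x : PSL2) : PSL2 := psl2_proj (repr x)^-1%g.

Lemma psl2_reprP (A : SL2) :
  val (repr (psl2_proj A)) = val A \/ val (repr (psl2_proj A)) = - val A.
Proof. by apply/psl2_projP; rewrite psl2_projK. Qed.

Lemma psl2_proj_mul (A B : SL2) :
  psl2_mul (psl2_proj A) (psl2_proj B) = psl2_proj (A * B)%g.
Proof.
apply/eqP/psl2_projP; rewrite !val_sl2M.
by case: (psl2_reprP A) (psl2_reprP B) => -> [] ->;
  rewrite ?(mulmxN, mulNmx) ?opprK; auto.
Qed.

Lemma invmx2N (A : 'M[C]_2) : invmx (- A) = - invmx A.
Proof. exact: invrN. Qed.

Lemma psl2_proj_inv (A : SL2) : psl2_inv (psl2_proj A) = psl2_proj A^-1%g.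
Proof.
apply/eqP/psl2_projP; rewrite !val_sl2V.
by case: (psl2_reprP A) => ->; rewrite ?invmx2N; auto.
Qed.

Lemma psl2_proj_surj (x : PSL2) : exists A, x = psl2_proj A.
Proof. by exists (repr x); rewrite psl2_projK. Qed.

Fact psl2_mulA : associative psl2_mul.
Proof.
move=> x y z; have [A ->] := psl2_proj_surj x;
have [B ->] := psl2_proj_surj y; have [D ->] := psl2_proj_surj z.
by rewrite !psl2_proj_mul mulgA.
Qed.
Fact psl2_mul1g : left_id psl2_one psl2_mul.
Proof. by move=> x; have [A ->] := psl2_proj_surj x; rewrite psl2_proj_mul mul1g. Qed.
Fact psl2_mulg1 : right_id psl2_one psl2_mul.
Proof. by move=> x; have [A ->] := psl2_proj_surj x; rewrite psl2_proj_mul mulg1. Qed.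
Fact psl2_mulVg : left_inverse psl2_one psl2_inv psl2_mul.
Proof. by move=> x; have [A ->] := psl2_proj_surj x; rewrite psl2_proj_inv psl2_proj_mul mulVg. Qed.
Fact psl2_mulgV : right_inverse psl2_one psl2_inv psl2_mul.
Proof. by move=> x; have [A ->] := psl2_proj_surj x; rewrite psl2_proj_inv psl2_proj_mul mulgV. Qed.

HB.instance Definition _ := isGroup.Build PSL2
  psl2_mulA psl2_mul1g psl2_mulg1 psl2_mulVg psl2_mulgV.

Fact psl2_projM : {morph psl2_proj : A B / (A * B)%g >-> (A * B)%g}.
Proof. by move=> A B; rewrite -psl2_proj_mul. Qed.

HB.instance Definition _ := isMultiplicative.Build SL2 PSL2 psl2_proj psl2_projM.

(** The isomorphism PSL_2(C) -> SO_3(C): the matrix of the adjoint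
    representation on sl_2(C) in the basis of Pauli matrices, which is
    orthonormal for the invariant form tr(XY)/2. *)
Definition pauli (j : 'I_3) : 'M[C]_2 :=
  nth 0 [:: \matrix_(a, b) (a != b)%:R;
            \matrix_(a, b) (if a == b then 0 else if a == 0 then - 'i else 'i);
            \matrix_(a, b) (if a == b then (-1) ^+ a else 0)] j.

Definition sl2_adjoint (A : SL2) : 'M[C]_3 :=
  \matrix_(j, l) (2^-1 * \tr (pauli j *m val A *m pauli l *m invmx (val A))).

Definition so3_of_psl2 (x : PSL2) : 'M[C]_3 := sl2_adjoint (repr x).

Lemma so3_of_psl2E (A : SL2) : so3_of_psl2 (psl2_proj A) = sl2_adjoint A.
Proof.
apply/matrixP => j l; rewrite !mxE.
by case: (psl2_reprP A) => ->; rewrite ?invmx2N ?(mulmxN, mulNmx) ?opprK.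
Qed.

End SL2.

(** * Representation spaces *)

Section Conjugation.
Variables (Gamma G : groupType).

Definition conj_fun (a : G) (rho : {multiplicative Gamma -> G}) (x : Gamma) : G :=
  (a * rho x * a^-1)%g.

Fact conj_funM a rho :
  {morph conj_fun a rho : x y / (x * y)%g >-> (x * y)%g}.
Proof. by move=> x y; rewrite /conj_fun gmulfM !mulgA mulgVK. Qed.

HB.instance Definition _ a rho :=
  isMultiplicative.Build Gamma G (conj_fun a rho) (conj_funM a rho).

Definition conj_hom (a : G) (rho : {multiplicative Gamma -> G}) :
  {multiplicative Gamma -> G} := conj_fun a rho.

End Conjugation.

Section Representations.
Variables (R : realType) (Gamma : groupType).
Local Notation C := R[i].
Local Notation SL2 := (SL2 R).
Local Notation PSL2 := (PSL2 R).

(** H^1(Gamma, C_2) *)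
Definition H1C2 : Type := {multiplicative Gamma -> C2}.

Definition twist_fun (eps : H1C2) (rho : {multiplicative Gamma -> SL2})
    (x : Gamma) : SL2 :=
  sl2_scale (eps x) (rho x).

Fact twist_funM eps rho :
  {morph twist_fun eps rho : x y / (x * y)%g >-> (x * y)%g}.
Proof. by move=> x y; rewrite /twist_fun !gmulfM sl2_scaleM. Qed.

HB.instance Definition _ eps rho :=
  isMultiplicative.Build Gamma SL2 (twist_fun eps rho) (twist_funM eps rho).

Definition proj_hom (rho : {multiplicative Gamma -> SL2}) :
  {multiplicative Gamma -> PSL2} := @psl2_proj R \o rho.

Section Spaces.
Variables (n : nat) (g : 'I_n -> Gamma).

(** R(Gamma, SL_2(C)) *)
Definition RSL2 : fspace R :=
  FSpace (polynomial_in
    (fun (rho : {multiplicative Gamma -> SL2}) (j : 'I_n * ('I_2 * 'I_2)) =>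
       val (rho (g j.1)) j.2.1 j.2.2)).

(** R(Gamma) *)
Definition RPSL2 : fspace R :=
  FSpace (polynomial_in
    (fun (rho : {multiplicative Gamma -> PSL2}) (j : 'I_n * ('I_3 * 'I_3)) =>
       so3_of_psl2 (rho (g j.1)) j.2.1 j.2.2)).

Definition lifts (rho : RPSL2) : Prop :=
  exists rho' : RSL2, forall x, psl2_proj (rho' x) = rho x.

Definition Rbar : fspace R := subspace lifts.

Definition conj_RSL2 (A : SL2) (rho : RSL2) : RSL2 := conj_hom A rho.

Definition twist_RSL2 (eps : H1C2) (rho : RSL2) : RSL2 := twist_fun eps rho.

Fact conj_Rbar_subproof (a : PSL2) (rho : Rbar) : lifts (conj_hom a (sval rho)).
Proof.
case: rho => rho [rho' rho'E]; have [A ->] := psl2_proj_surj a.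
exists (conj_hom A rho') => x; rewrite /= /conj_fun !psl2_projM rho'E.
by congr (_ * _)%g; rewrite -psl2_proj_inv.
Qed.

Definition conj_Rbar (a : PSL2) (rho : Rbar) : Rbar :=
  exist _ (conj_hom a (sval rho)) (conj_Rbar_subproof a rho).

Fact proj_Rbar_subproof (rho : RSL2) : lifts (proj_hom rho).
Proof. by exists rho. Qed.

(** Composition with the projection SL_2(C) -> PSL_2(C). *)
Definition proj_Rbar (rho : RSL2) : Rbar :=
  exist _ (proj_hom rho) (proj_Rbar_subproof rho).

End Spaces.

End Representations.

(* Main.v *)
(** Fix Gamma, generated by the g_i.  Let E be the algebra of functions on
    R(Gamma, SL_2) that are polynomial in the entries of the Ad rho(g_i), that is,
    the pullback of the coordinate ring of the liftable representations.  The point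
    is that a regular function invariant under H^1(Gamma, C_2) lies in E.

    Call u of weight h in Gamma when u times each entry of rho(h) lies in E.
    Products of two entries of the same rho(h) lie in E, so entries of rho(h) have
    weight h; weights multiply, so every regular function is a finite sum of
    functions having a weight, and a character eps multiplies weight h by eps(h).
    Invariance thus leaves only weights h with eps(h) = 1 for all eps.  Such h are
    products of squares, so the entries of rho(h) are in E, and then so is every
    function of weight h, because det rho(h) = 1.

    As regular functions on both quotients then correspond, and a map into an
    affine set is a homomorphism of coordinate rings, the isomorphism follows. *)
Require Import Defs.
From HB Require Import structures.
From mathcomp Require Import all_boot all_order all_algebra.
From mathcomp Require Import reals complex.
From mathcomp Require Import ring.
From mathcomp.multinomials Require Import mpoly.

Set Implicit Arguments.
Unset Strict Implicit.
Unset Printing Implicit Defensive.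

Import GRing.Theory.

Local Open Scope ring_scope.

(** * Subalgebras of functions and maps between affine sets *)

Section PolynomialFunctions.
Variable R : realType.
Local Notation C := R[i].

Record subalgebra (T : Type) (E : (T -> C) -> Prop) : Prop := Subalgebra {
  subalg_ext : forall u v, u =1 v -> E u -> E v;
  subalg_const : forall c, E (fun=> c);
  subalg_add : forall u v, E u -> E v -> E (fun x => u x + v x);
  subalg_mul : forall u v, E u -> E v -> E (fun x => u x * v x) }.

Lemma subalg_sum (T : Type) (E : (T -> C) -> Prop) (I : Type) (s : seq I)
    (u : I -> T -> C) :
  subalgebra E -> (forall i, E (u i)) -> E (fun x => \sum_(i <- s) u i x).
Proof.
move=> [ext cst add _] Eu; elim: s => [|i s IHs].
  by apply: ext (cst 0) => x; rewrite big_nil.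
by apply: ext (add _ _ (Eu i) IHs) => x; rewrite big_cons.
Qed.

Lemma subalg_prod (T : Type) (E : (T -> C) -> Prop) (I : Type) (s : seq I)
    (u : I -> T -> C) :
  subalgebra E -> (forall i, E (u i)) -> E (fun x => \prod_(i <- s) u i x).
Proof.
move=> [ext cst _ mul] Eu; elim: s => [|i s IHs].
  by apply: ext (cst 1) => x; rewrite big_nil.
by apply: ext (mul _ _ (Eu i) IHs) => x; rewrite big_cons.
Qed.

Lemma subalg_exp (T : Type) (E : (T -> C) -> Prop) (u : T -> C) (n : nat) :
  subalgebra E -> E u -> E (fun x => u x ^+ n).
Proof.
move=> [ext cst _ mul] Eu; elim: n => [|n IHn]; first exact: ext (cst 1) => x.
by apply: ext (mul _ _ Eu IHn) => x; rewrite exprS.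
Qed.

Lemma subalg_peval (T : Type) (E : (T -> C) -> Prop) (I : finType)
    (p : {mpoly C[#|I|]}) (c : T -> I -> C) :
  subalgebra E -> (forall i, E (c^~ i)) -> E (fun x => peval p (c x)).
Proof.
move=> Ealg Ec; have [ext cst _ mul] := Ealg.
pose e x := \sum_(m <- msupp p) p@_m * \prod_i c x (enum_val i) ^+ m i.
apply: (ext e) => [x|]; first by rewrite /peval mevalE.
apply: subalg_sum => // m; apply: mul => //.
by apply: subalg_prod => // i; apply: subalg_exp.
Qed.

Lemma polynomial_in_subalgebra (T : Type) (I : finType) (c : T -> I -> C) :
  subalgebra (polynomial_in c).
Proof.
split=> [u v uv [p pE]|a|u v [p pE] [q qE]|u v [p pE] [q qE]].
- by exists p => x; rewrite -uv.
- by exists a%:MP => x; rewrite /peval mevalC.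
- by exists (p + q) => x; rewrite /peval mevalD pE qE.
- by exists (p * q) => x; rewrite /peval mevalM pE qE.
Qed.

Lemma polynomial_in_coord (T : Type) (I : finType) (c : T -> I -> C) (i : I) :
  polynomial_in c (c^~ i).
Proof. by exists 'X_(enum_rank i) => x; rewrite /peval mevalXU enum_rankK. Qed.

Lemma polynomial_in_sub (T : Type) (I : finType) (c : T -> I -> C)
    (E : (T -> C) -> Prop) (u : T -> C) :
  subalgebra E -> (forall i, E (c^~ i)) -> polynomial_in c u -> E u.
Proof.
move=> Ealg Ec [p pE]; apply: (subalg_ext Ealg (fun x => esym (pE x))).
exact: subalg_peval.
Qed.

Lemma peval_eq (I : finType) (p : {mpoly C[#|I|]}) (z z' : I -> C) :
  z =1 z' -> peval p z = peval p z'.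
Proof. by move=> zz'; apply: meval_eq => i; apply: zz'. Qed.

Lemma affine_subalgebra (X : fspace R) : affine X -> subalgebra (@regular R X).
Proof.
move=> [I [e [_ _ regE]]].
have [ext cst add mul] := polynomial_in_subalgebra e.
split=> [u v uv /regE Xu|a|u v /regE Xu /regE Xv|u v /regE Xu /regE Xv];
  apply/regE; [exact: ext Xu | exact: cst | exact: add | exact: mul].
Qed.

(** A map into an affine set amounts to a homomorphism of coordinate rings, here
    presented by the pullbacks of functions to an auxiliary space [Z] on which
    functions of [A] are determined. *)
Lemma affine_factor (Z : Type) (A B : fspace R) (a : Z -> A) (b : Z -> B) :
  affine A -> affine B ->
  (forall u v : A -> C, regular u -> regular v ->
    (forall z, u (a z) = v (a z)) -> u =1 v) ->
  (forall u : B -> C, regular u ->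
    exists2 u' : A -> C, regular u' & forall z, u' (a z) = u (b z)) ->
  exists2 f : A -> B, regular_map f & forall z, f (a z) = b z.
Proof.
move=> Aaff [I [e [e_inj [S SP] regE]]] Adense pull.
have Aalg := affine_subalgebra Aaff.
have pull_e i : exists u : A -> C,
    regular u /\ forall z, u (a z) = e (b z) i.
  have [|u' u'reg u'E] := pull (e^~ i); last by exists u'.
  by apply/regE/polynomial_in_coord.
have [c cP] := boolp.choice pull_e.
have c_reg p : regular (fun x => peval p (c^~ x)).
  by apply: subalg_peval => // i; case: (cP i).
(* An equation of [B] in these coordinates is a regular function on [A] whose pullback to [Z]
   vanishes, so it vanishes on [A]. *)
have c_img x : exists y : B, e y =1 c^~ x.
  apply/(SP (c^~ x)) => p Sp.
  suff -> : peval p (c^~ x) = (fun=> 0) x by [].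
  apply: (Adense (fun x => peval p (c^~ x)) (fun=> 0)) => //.
    exact: (subalg_const Aalg).
  move=> z; rewrite (@peval_eq _ _ _ (e (b z))) => [|i]; last first.
    by case: (cP i).
  by move: p Sp; apply/(SP (e (b z))); exists (b z).
have [f fE] := boolp.choice c_img.
exists f => [u /regE[p pE]|z].
  apply: (subalg_ext Aalg) (c_reg p) => x; rewrite pE.
  by apply: peval_eq => i; rewrite fE.
by apply: e_inj => i; rewrite fE; case: (cP i).
Qed.

(** Both composites are the identity because the coordinates are determined by their pullbacks to
    [Z]. *)
Lemma affine_isomorphism (Z : Type) (A B : fspace R) (a : Z -> A) (b : Z -> B) :
  affine A -> affine B ->
  (forall u v : A -> C, regular u -> regular v ->
    (forall z, u (a z) = v (a z)) -> u =1 v) ->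
  (forall u v : B -> C, regular u -> regular v ->
    (forall z, u (b z) = v (b z)) -> u =1 v) ->
  (forall u : A -> C, regular u ->
    exists2 u' : B -> C, regular u' & forall z, u' (b z) = u (a z)) ->
  (forall u : B -> C, regular u ->
    exists2 u' : A -> C, regular u' & forall z, u' (a z) = u (b z)) ->
  exists f : A -> B, isomorphism f /\ forall z, f (a z) = b z.
Proof.
have inverse (A' B' : fspace R) (a' : Z -> A') (b' : Z -> B')
    (f : A' -> B') (h : B' -> A') : affine A' ->
  (forall u v : A' -> C, regular u -> regular v ->
    (forall z, u (a' z) = v (a' z)) -> u =1 v) ->
  regular_map f -> regular_map h ->
  (forall z, f (a' z) = b' z) -> (forall z, h (b' z) = a' z) -> cancel f h.
  move=> [I [e [e_inj _ regE]]] dense freg hreg fE hE x.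
  apply: e_inj => i; have ei : regular (e^~ i) by apply/regE/polynomial_in_coord.
  apply: (dense (fun x => e (h (f x)) i) (e^~ i)) => //.
    exact: (freg (fun y => e (h y) i)) (hreg (e^~ i) ei).
  by move=> z; rewrite fE hE.
move=> Aaff Baff Adense Bdense AB BA.
have [f freg fE] := affine_factor Aaff Baff Adense BA.
have [h hreg hE] := affine_factor Baff Aaff Bdense AB.
exists f; split=> //; exists h; split=> //.
- exact: (inverse _ _ a b).
- exact: (inverse _ _ b a).
Qed.

End PolynomialFunctions.

(** * Entrywise formulas for two by two matrices *)

Lemma ord2P (P : 'I_2 -> Prop) : P 0 -> P 1 -> forall j, P j.
Proof.
move=> P0 P1 [[|[|//]] lt_j2].
  by rewrite (_ : Ordinal _ = 0) //; apply: val_inj.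
by rewrite (_ : Ordinal _ = 1) //; apply: val_inj.
Qed.

Section Matrices2.
Variable K : comUnitRingType.

Lemma mulmx2E (A B : 'M[K]_2) j k :
  (A *m B) j k = A j 0 * B 0 k + A j 1 * B 1 k.
Proof.
rewrite mxE !big_ord_recl big_ord0 addr0.
by rewrite (_ : lift _ _ = 1) //; apply: val_inj.
Qed.

Lemma det_mx2E (A : 'M[K]_2) : \det A = A 0 0 * A 1 1 - A 0 1 * A 1 0.
Proof.
have l01 : lift 0 0 = 1 :> 'I_2 by apply: val_inj.
have l10 : lift 1 0 = 0 :> 'I_2 by apply: val_inj.
rewrite (expand_det_row _ 0) !big_ord_recl big_ord0 /cofactor !det_mx11 !mxE.
by rewrite !(l01, l10) addr0 mul1r expr1 mulN1r mulrN.
Qed.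

Lemma rev_ord2 : (rev_ord (0 : 'I_2) = 1) * (rev_ord (1 : 'I_2) = 0).
Proof. by split; apply: val_inj. Qed.

(** This is the adjugate; [rev_ord] exchanges the two indices. *)
Lemma invmx2E (A : 'M[K]_2) j k : \det A = 1 ->
  invmx A j k = (-1) ^+ (j + k) * A (rev_ord k) (rev_ord j).
Proof.
move=> detA; pose B : 'M[K]_2 := \matrix_(j, k)
  ((-1) ^+ (j + k) * A (rev_ord k) (rev_ord j)).
suff -> : invmx A = B by rewrite mxE.
suff AB : A *m B = 1%:M.
  by rewrite -[B](@mulKmx _ _ _ A) ?AB ?mulmx1 // unitmxE detA unitr1.
have {}detA : A 0 0 * A 1 1 = 1 + A 0 1 * A 1 0.
  by rewrite -detA det_mx2E subrK.
apply/matrixP; elim/ord2P; elim/ord2P; rewrite mulmx2E !mxE !rev_ord2 /=;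
  ring: detA.
Qed.

Lemma mxtrace2E (A : 'M[K]_2) : \tr A = A 0 0 + A 1 1.
Proof.
rewrite /mxtrace !big_ord_recl big_ord0 addr0.
by rewrite (_ : lift _ _ = 1) //; apply: val_inj.
Qed.

End Matrices2.

(** * Pauli matrices and the adjoint representation *)

Section SL2Entries.
Variable R : realType.
Local Notation C := R[i].

Lemma pauli_trace j : \tr (pauli R j) = 0.
Proof.
case: j => [[|[|[|//]]] ?]; rewrite mxtrace2E !mxE /= ?addr0 //.
by rewrite expr0 expr1 subrr.
Qed.

(** The identity and the Pauli matrices are orthogonal for tr(XY), each of square norm 2. *)
Lemma pauli_expansion (A : 'M[C]_2) :
  A = 2^-1 *: ((\tr A)%:M + \sum_j \tr (pauli R j *m A) *: pauli R j).
Proof.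
have i2 : 'i%C * 'i%C = -1 :> C by rewrite -expr2 sqr_i.
rewrite !big_ord_recl big_ord0 addr0 /pauli /=.
apply/matrixP; elim/ord2P; elim/ord2P;
  rewrite 3!mxE !mxtrace2E !mulmx2E !mxE /= -?complexiE ?modn_small //;
  by field: i2.
Qed.

(** Both sides are the entry (j, k) of A E_pq A^-1, on the right after expanding
    both E_pq and the conjugate matrix in the basis of 1 and the Pauli matrices. *)
Lemma conj_entries_adjoint (A : SL2 R) j p q k :
  val A j p * invmx (val A) q k =
    2^-1 * (\tr (delta_mx p q : 'M[C]_2) * (j == k)%:R +
      \sum_m (\sum_l \tr (pauli R l *m delta_mx p q) * sl2_adjoint A m l) *
        pauli R m j k).
Proof.
pose D : 'M[C]_2 := delta_mx p q; pose Y := val A *m D *m invmx (val A).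
have trY : \tr Y = \tr D.
  by rewrite mxtrace_mulC mulmxA mulVmx ?SL2_unit // mul1mx.
have -> : val A j p * invmx (val A) q k = Y j k.
  rewrite mxE (bigD1 q) //= big1 ?addr0 => [|r neq_rq].
    rewrite mxE (bigD1 p) //= big1 ?addr0 => [|s neq_sp].
      by rewrite mxE !eqxx mulr1.
    by rewrite mxE (negPf neq_sp) mulr0.
  rewrite mxE big1 ?mul0r // => s _.
  by rewrite mxE (negPf neq_rq) andbF mulr0.
rewrite [Y]pauli_expansion trY mxE mxE mxE summxE.
congr (_ * (_ + _)); first by rewrite mulr_natr.
apply: eq_bigr => m _; rewrite mxE; congr (_ * _).
(* [Z] has trace 0, so the identity component of [D] contributes nothing to tr(DZ). *)
pose Z := invmx (val A) *m pauli R m *m val A.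
have trZ : \tr Z = 0.
  by rewrite mxtrace_mulC mulmxA mulmxV ?SL2_unit // mul1mx pauli_trace.
have -> : \tr (pauli R m *m Y) = \tr (D *m Z).
  by rewrite mxtrace_mulC -mulmxA mxtrace_mulC /Y /Z !mulmxA mxtrace_mulC !mulmxA.
rewrite {1}[D]pauli_expansion -scalemxAl mulmxDl mul_scalar_mx mxtraceZ.
rewrite mxtraceD mxtraceZ trZ mulr0 add0r mulmx_suml raddf_sum mulr_sumr.
apply: eq_bigr => l _; rewrite /= -scalemxAl mxtraceZ /sl2_adjoint mxE mulrCA.
congr (_ * (_ * _)).
by rewrite /Z mxtrace_mulC -!mulmxA [LHS]mxtrace_mulC !mulmxA.
Qed.

End SL2Entries.

(** * Characters with values in C_2 of a finitely generated group *)

Section GroupHom.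
Local Open Scope group_scope.

Lemma multiplicative1 (G H : groupType) (f : {multiplicative G -> H}) : f 1 = 1.
Proof. by apply: (mulgI (f 1)); rewrite -gmulfM !mulg1. Qed.

Lemma multiplicativeV (G H : groupType) (f : {multiplicative G -> H}) x :
  f x^-1 = (f x)^-1.
Proof.
by apply: (mulgI (f x)); rewrite -gmulfM !mulgV multiplicative1.
Qed.

Record subgroup (G : groupType) (N : G -> Prop) : Prop := Subgroup {
  subgroup1 : N 1;
  subgroupM : forall x y, N x -> N y -> N (x * y);
  subgroupV : forall x, N x -> N x^-1 }.

Variables (Gamma : groupType) (n : nat) (g : 'I_n -> Gamma).
Hypothesis gP : generates g.

Definition c2_opp1 : C2 := Sub (-1 : int) isT.

Lemma C2_cases (s : C2) : s = 1 \/ s = c2_opp1.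
Proof.
by case: s => s /= s_unit; case/orP: (s_unit) => /eqP sE; [left | right];
  apply: val_inj.
Qed.

Section SquareSubgroup.
Variable N : Gamma -> Prop.
Hypotheses (Nsub : subgroup N) (Nsq : forall x, N (x * x)).

Lemma square_subgroupJ x y : N y -> N (x * y * x^-1).
Proof.
case: Nsub => N1 NM NV Ny.
have -> : x * y * x^-1 = (x * y * (x * y)) * y^-1 * (x^-1 * x^-1).
  by rewrite !mulgA !mulgK.
by do 2!apply: (NM) => //; apply: NV.
Qed.

(** All squares lie in [N], so [N (x * y)] says that [x] and [y] have the same class modulo [N];
    this is symmetry, the next lemma transitivity. *)
Lemma square_subgroup_comm x y : N (x * y) -> N (y * x).
Proof. by move/(square_subgroupJ y); rewrite !mulgA mulgK. Qed.

Lemma square_subgroup_trans x y z : N (x * y) -> N (y * z) -> N (x * z).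
Proof.
case: Nsub => N1 NM NV Nxy Nyz.
have -> : x * z = x * y * (y^-1 * y^-1) * (y * z) by rewrite !mulgA mulgK mulgVK.
by do 2!apply: (NM) => //.
Qed.

(** As [a * a] lies in [N], [N (x * a)] describes the coset of [a]. *)
Lemma square_subgroup_adjoin a : subgroup (fun x => N x \/ N (x * a)).
Proof.
have [N1 NM NV] := Nsub; split=> [|x y [Nx|Nxa] [Ny|Nya]|x [Nx|Nxa]].
- by left.
- by left; apply: NM.
- by right; rewrite -mulgA; apply: NM.
- by right; rewrite (_ : _ * a = x * y * x^-1 * (x * a));
    [apply: NM; [apply: square_subgroupJ |] | rewrite !mulgA mulgVK].
- by left; apply: square_subgroup_trans Nxa _; apply: square_subgroup_comm.
- by left; apply: NV.
- by right; apply: square_subgroup_trans Nxa; rewrite mulVg.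
Qed.

Lemma index2_character h : ~ N h -> (forall x, N x \/ N (x * h)) ->
  exists eps : H1C2 Gamma, (forall x, N x -> eps x = 1) /\ eps h = c2_opp1.
Proof.
have [N1 NM NV] := Nsub; move=> Nh Nindex.
pose f (x : Gamma) : C2 := if boolp.pselect (N x) then 1 else c2_opp1.
have f1 x : N x -> f x = 1 by rewrite /f; case: boolp.pselect.
have fN x : ~ N x -> f x = c2_opp1 by rewrite /f; case: boolp.pselect.
have fM : {morph f : x y / x * y >-> x * y}.
  move=> x y.
  case: (boolp.pselect (N x)) => Nx; case: (boolp.pselect (N y)) => Ny.
  - by rewrite !f1 ?mulg1 //; apply: NM.
  - rewrite (f1 x) // !fN ?mul1g // => Nxy; apply: Ny.
    by rewrite -(mulKg x y); apply: NM => //; apply: NV.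
  - rewrite (f1 y) // !fN ?mulg1 // => Nxy; apply: Nx.
    by rewrite -(mulgK y x); apply: NM => //; apply: NV.
  - rewrite (fN x) // (fN y) // f1; first exact: val_inj.
    (* Two elements outside [N] both lie in the class of [h], so their product lies in [N]. *)
    have [//|Nxh] := Nindex x; have [//|Nyh] := Nindex y.
    by apply: square_subgroup_trans Nxh _; apply: square_subgroup_comm.
pose eps : H1C2 Gamma := HB.pack f (isMultiplicative.Build Gamma C2 f fM).
by exists eps; split; [exact: f1 | exact: fN].
Qed.

End SquareSubgroup.

(** Linear algebra over the field with two elements: the quotient by [N] has finite dimension, and
    some linear form is nonzero on the class of [h]. *)
Lemma square_subgroup_separation (N : Gamma -> Prop) h :
  subgroup N -> (forall x, N (x * x)) -> ~ N h ->
  exists eps : H1C2 Gamma, (forall x, N x -> eps x = 1) /\ eps h = c2_opp1.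
Proof.
move=> Nsub Nsq Nh.
(* M grows by the generators whose addition keeps h out; the other generators
   end up in M h, so that M has index 2. *)
have chain k : (k <= n)%N ->
    exists M : Gamma -> Prop, [/\ subgroup M, ~ M h & forall x, N x -> M x] /\
    forall i : 'I_n, (i < k)%N -> M (g i) \/ M (g i * h).
  elim: k => [|k IHk] lt_kn; first by exists N.
  have [M [[Msub Mh NM] Mg]] := IHk (ltnW lt_kn).
  have Msq x : M (x * x) by apply: NM.
  pose a := g (Ordinal lt_kn).
  have [Ma|Ma] := boolp.pselect (M a \/ M (a * h)).
    exists M; split=> // i.
    rewrite ltnS leq_eqVlt => /predU1P[ik|]; last exact: Mg.
    by rewrite (_ : i = Ordinal lt_kn) //; apply: val_inj.
  exists (fun x => M x \/ M (x * a)); split.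
    split=> [|[//|Mha]|x Nx]; first exact: square_subgroup_adjoin.
    - by apply: Ma; right; apply: square_subgroup_comm.
    - by left; apply: NM.
  move=> i; rewrite ltnS leq_eqVlt => /predU1P[ik|lt_ik].
    by left; right; rewrite (_ : i = Ordinal lt_kn) //; apply: val_inj.
  by have [] := Mg i lt_ik; [left; left | right; left].
have [M [[Msub Mh NM] Mg]] := chain n (leqnn n).
have Msq x : M (x * x) by apply: NM.
(* The subgroup generated by [M] and [h] contains every [g i], hence is everything. *)
have [M1 MM MV] := square_subgroup_adjoin Msub Msq h.
have [|eps [epsM epsh]] := index2_character Msub Msq Mh.
  by move=> x; apply: (gP M1 MM MV) => i; apply: Mg.
by exists eps; split=> // x /NM; apply: epsM.
Qed.

End GroupHom.

(** * Weights and twist-invariant functions *)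

Section Descent.
Variables (R : realType) (Gamma : groupType) (n : nat) (g : 'I_n -> Gamma).
Hypothesis gP : generates g.
Local Notation C := R[i].
Local Notation Rep := {multiplicative Gamma -> SL2 R}.

Definition entry (h : Gamma) (j k : 'I_2) (rho : Rep) : C := val (rho h) j k.

Definition adjoint_regular : (Rep -> C) -> Prop :=
  polynomial_in (fun (rho : Rep) (j : 'I_n * ('I_3 * 'I_3)) =>
    sl2_adjoint (rho (g j.1)) j.2.1 j.2.2).

Lemma adjoint_regular_alg : subalgebra adjoint_regular.
Proof. exact: polynomial_in_subalgebra. Qed.

Lemma entryM h h' j k rho :
  entry (h * h')%g j k rho =
    entry h j 0 rho * entry h' 0 k rho + entry h j 1 rho * entry h' 1 k rho.
Proof. by rewrite /entry gmulfM mulmx2E. Qed.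

Lemma entry1 j k rho : entry 1%g j k rho = (j == k)%:R.
Proof. by rewrite /entry multiplicative1 mxE. Qed.

Lemma entryV h j k rho :
  entry h^-1%g j k rho = (-1) ^+ (j + k) * entry h (rev_ord k) (rev_ord j) rho.
Proof. by rewrite /entry multiplicativeV invmx2E ?SL2_det. Qed.

Lemma entry_det h rho :
  entry h 0 0 rho * entry h 1 1 rho - entry h 0 1 rho * entry h 1 0 rho = 1.
Proof. by rewrite /entry -(det_mx2E (val (rho h))) SL2_det. Qed.

Lemma entry_twist (eps : H1C2 Gamma) h j k (rho : RSL2 R g) :
  entry h j k (twist_RSL2 eps rho) = (val (eps h))%:~R * entry h j k rho.
Proof. by rewrite /entry mxE. Qed.

(** Induction on the generation of [h]: products and inverses only regroup such pairs, so the
    generators carry the content. *)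
Lemma entry_pair_adjoint h j k l m :
  adjoint_regular (fun rho => entry h j k rho * entry h l m rho).
Proof.
have [ext cst add mul] := adjoint_regular_alg.
move: h j k l m; apply: gP => [|h h' Eh Eh'|h Eh|i] j k l m.
- by apply: ext (cst ((j == k)%:R * (l == m)%:R)) => rho; rewrite !entry1.
- pose term p q rho := entry h j p rho * entry h l q rho *
    (entry h' p k rho * entry h' q m rho).
  have Eterm p q : adjoint_regular (term p q) by apply: (mul).
  apply: ext (add _ _ (add _ _ (Eterm 0 0) (Eterm 0 1))
                      (add _ _ (Eterm 1 0) (Eterm 1 1))) => rho.
  by rewrite /term !entryM; ring.
- apply: ext (mul _ _ (cst ((-1) ^+ (j + k + (l + m)))) (Eh (rev_ord k)
    (rev_ord j) (rev_ord m) (rev_ord l))) => rho.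
  by rewrite !entryV exprD; ring.
(* The second factor is, up to sign, an entry of the inverse, which turns the product into an entry
   of a conjugated matrix unit. *)
- pose u rho :=
    entry (g i) j k rho * entry (g i)^-1%g (rev_ord m) (rev_ord l) rho.
  apply: (ext (fun rho => (-1) ^+ (rev_ord m + rev_ord l) * u rho)) => [rho|].
    by rewrite /u entryV !rev_ordK mulrCA signrMK.
  apply: (mul) => //; rewrite /u.
  have Ei a b : adjoint_regular (fun rho => sl2_adjoint (rho (g i)) a b).
    exact: polynomial_in_coord (i, (a, b)).
  have conjE rho := conj_entries_adjoint (rho (g i)) j k (rev_ord m) (rev_ord l).
  under [X in _ X]boolp.eq_fun do rewrite /entry multiplicativeV conjE.
  apply: (mul); first exact: cst.
  apply: (add); first exact: cst.
  apply: subalg_sum => // a; apply: (mul); last exact: cst.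
  by apply: subalg_sum => // b; apply: (mul); first exact: cst.
Qed.

Definition adjoint_group (h : Gamma) : Prop :=
  forall j k, adjoint_regular (entry h j k).

(** Since rho(h) has determinant 1, these u form the module spanned by the entries
    of rho(h) over [adjoint_regular]. *)
Definition weight (h : Gamma) (u : Rep -> C) : Prop :=
  forall j k, adjoint_regular (fun rho => u rho * entry h j k rho).

Lemma weight_expand h u rho :
  u rho = u rho * entry h 0 0 rho * entry h 1 1 rho
        - u rho * entry h 0 1 rho * entry h 1 0 rho.
Proof. by rewrite -!mulrA -mulrBr entry_det mulr1. Qed.

Lemma weightM h h' u v :
  weight h u -> weight h' v -> weight (h * h')%g (fun rho => u rho * v rho).
Proof.
have [ext _ add mul] := adjoint_regular_alg.
move=> hu h'v j k.
apply: ext (add _ _ (mul _ _ (hu j 0) (h'v 0 k)) (mul _ _ (hu j 1) (h'v 1 k))).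
by move=> rho; rewrite entryM; ring.
Qed.

Lemma weight_cst c : weight 1%g (fun=> c).
Proof.
have [ext cst _ _] := adjoint_regular_alg.
by move=> j k; apply: ext (cst (c * (j == k)%:R)) => rho; rewrite entry1.
Qed.

Lemma weight_adjoint h u :
  adjoint_group h -> weight h u -> adjoint_regular u.
Proof.
have [ext cst add mul] := adjoint_regular_alg.
move=> Eh hu; pose v rho := u rho * entry h 0 0 rho * entry h 1 1 rho
  + -1 * (u rho * entry h 0 1 rho * entry h 1 0 rho).
apply: (ext v) => [rho|].
  by rewrite [RHS](weight_expand h) /v mulN1r.
apply: (add); first exact: mul.
by apply: (mul (fun=> -1)); [exact: cst | apply: (mul)].
Qed.

Lemma adjoint_group_subgroup : subgroup adjoint_group.
Proof.
have [ext cst add mul] := adjoint_regular_alg.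
split=> [|h h' Eh Eh'|h Eh] j k.
- by apply: ext (cst (j == k)%:R) => rho; rewrite entry1.
- apply: (ext _ _ (fun rho => esym (entryM h h' j k rho))).
  by apply: (add); apply: (mul).
- apply: (ext _ _ (fun rho => esym (entryV h j k rho))).
  by apply: (mul); first exact: cst.
Qed.

Lemma adjoint_group_square h : adjoint_group (h * h)%g.
Proof.
have [ext _ add _] := adjoint_regular_alg.
move=> j k; apply: (ext _ _ (fun rho => esym (entryM h h j k rho))).
by apply: (add); apply: entry_pair_adjoint.
Qed.

(** [adjoint_group] is a subgroup containing all squares, so if [h] were outside it some character
    would be -1 at [h]. *)
Lemma adjoint_group_characters h :
  (forall eps : H1C2 Gamma, eps h = 1%g) -> adjoint_group h.
Proof.
move=> eps1; have [//|Nh] := boolp.pselect (adjoint_group h).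
have [eps [_]] := square_subgroup_separation gP adjoint_group_subgroup
  adjoint_group_square Nh.
by rewrite eps1 => /(congr1 val).
Qed.

Lemma adjoint_regular_twist u (eps : H1C2 Gamma) (rho : RSL2 R g) :
  adjoint_regular u -> u (twist_RSL2 eps rho) = u rho.
Proof.
case=> p pE; rewrite !pE; apply: peval_eq => -[i [a b]] /=.
rewrite -!so3_of_psl2E; congr (so3_of_psl2 _ _ _); apply/eqP/psl2_projP.
rewrite /= /twist_fun; case: (C2_cases (eps (g i))) => -> /=; [left|right].
  by rewrite scale1r.
by rewrite scaleN1r.
Qed.

(** The product of [u] with an entry of rho(h) is fixed by twisting, so [u] changes by the same sign
    as the entry. *)
Lemma weight_twist h u (eps : H1C2 Gamma) (rho : RSL2 R g) :
  weight h u -> u (twist_RSL2 eps rho) = (val (eps h))%:~R * u rho.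
Proof.
move=> hu; set e := (val (eps h))%:~R.
have ee : e * e = 1.
  by rewrite /e; case: (C2_cases (eps h)) => -> /=; rewrite ?mulrNN mulr1.
have uE j k : u (twist_RSL2 eps rho) * (e * entry h j k rho) =
    u rho * entry h j k rho.
  have := adjoint_regular_twist eps rho (hu j k).
  by rewrite /= entry_twist.
(* Any single entry may vanish, so the entries are eliminated through the determinant, which is
   1. *)
rewrite [u rho](weight_expand h) -!uE -[LHS]mulr1 -(entry_det h rho).
rewrite -[u _ in LHS]mul1r -ee; ring.
Qed.

Definition graded_sum (u : Rep -> C) : Prop :=
  exists (I : finType) (h : I -> Gamma) (w : I -> Rep -> C),
    (forall i, weight (h i) (w i)) /\ forall rho, u rho = \sum_i w i rho.

Lemma graded_sum_weight h u : weight h u -> graded_sum u.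
Proof.
move=> hu; exists unit, (fun=> h), (fun=> u); split=> // rho.
by rewrite big_const card_unit /= addr0.
Qed.

Lemma graded_sum_alg : subalgebra graded_sum.
Proof.
split=> [u v uv [I [h [w [hw uE]]]]|c
        |u v [I [h [w [hw uE]]]] [J [h' [w' [hw' vE]]]]
        |u v [I [h [w [hw uE]]]] [J [h' [w' [hw' vE]]]]].
- by exists I, h, w; split=> // rho; rewrite -uv.
- exact: graded_sum_weight (weight_cst c).
- exists (I + J)%type, (fun i => match i with inl i => h i | inr j => h' j end),
    (fun i => match i with inl i => w i | inr j => w' j end).
  by split=> [[i|j]|rho] //; rewrite big_sumType uE vE.
- exists (I * J)%type, (fun i => h i.1 * h' i.2)%g,
    (fun i rho => w i.1 rho * w' i.2 rho).
  split=> [i|rho]; first exact: weightM.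
  rewrite uE vE mulr_suml; under eq_bigr do rewrite mulr_sumr.
  by rewrite pair_bigA.
Qed.

Lemma regular_graded_sum (u : RSL2 R g -> C) : regular u -> graded_sum u.
Proof.
apply: polynomial_in_sub graded_sum_alg _ => -[i [j k]].
apply: (@graded_sum_weight (g i)) => a b; exact: entry_pair_adjoint.
Qed.

(** Descent on the set [A] of remaining terms: a character nontrivial on some weight in [A] removes
    at least one term, and when there is none all weights left lie in [adjoint_group]. *)
Lemma invariant_adjoint_regular (u : RSL2 R g -> C) :
  regular u -> Defs.invariant (@twist_RSL2 R Gamma n g) u -> adjoint_regular u.
Proof.
have [ext cst add mul] := adjoint_regular_alg.
move=> /regular_graded_sum[I [h [w [hw uE]]]] uinv.
have : forall rho, u rho = \sum_(i in [set: I]) w i rho.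
  by move=> rho; rewrite uE; apply: eq_bigl => i; rewrite inE.
have [m] := ubnP #|[set: I]|; move: [set: I] => A; elim: m A => // m IHm A ltAm {}uE.
have [[i [eps [iA epsi]]]|Aeps] := boolp.pselect (exists i (eps : H1C2 Gamma),
    i \in A /\ eps (h i) <> 1%g).
  pose B := [set i in A | eps (h i) == 1%g].
  apply: (IHm B).
    rewrite ltnS in ltAm; apply: leq_trans ltAm; apply: proper_card.
    apply/properP; split; first by apply/subsetP => j; rewrite inE => /andP[].
    by exists i => //; rewrite inE iA; apply/eqP.
  (* in 2 u = eps u + u the terms on which eps acts by -1 cancel *)
  move=> rho; apply: (mulfI (x := 2%:R)); first by rewrite Num.Theory.pnatr_eq0.
  rewrite mulr_natl mulr2n -{1}(uinv eps) !uE -big_split mulr_sumr /=.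
  rewrite (bigID (fun j => eps (h j) == 1%g)) /= [X in _ + X]big1 ?addr0.
    apply: eq_big => [j|j /andP[jA /eqP epsj]]; first by rewrite inE.
    by rewrite (weight_twist eps rho (hw j)) epsj mul1r mulr_natl.
  move=> j /andP[jA /eqP epsj]; rewrite (weight_twist eps rho (hw j)).
  by case: (C2_cases (eps (h j))) epsj => // -> _; rewrite mulN1r addNr.
(* Extension by zero, since [subalg_sum] requires every summand to lie in the algebra. *)
pose v i rho := if i \in A then w i rho else 0.
apply: (ext (fun rho => \sum_i v i rho)) => [rho|].
  by rewrite uE [RHS]big_mkcond.
apply: subalg_sum => // i; rewrite /v; case iA: (i \in A); last exact: cst.
apply: (weight_adjoint (h := h i)) => //; apply: adjoint_group_characters => eps.
by case: (boolp.pselect (eps (h i) = 1%g)) => // epsi; case: Aeps; exists i, eps.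
Qed.

End Descent.

(** * Regular functions on liftable representations *)

Section Rbar.
Variables (R : realType) (Gamma : groupType) (n : nat) (g : 'I_n -> Gamma).
Local Notation C := R[i].

Lemma subalg_mulmx (T : Type) (E : (T -> C) -> Prop) m p q
    (A : T -> 'M[C]_(m, p)) (B : T -> 'M[C]_(p, q)) :
  subalgebra E -> (forall j k, E (fun x => A x j k)) ->
  (forall j k, E (fun x => B x j k)) -> forall j k, E (fun x => (A x *m B x) j k).
Proof.
move=> Ealg EA EB j k; have [ext _ _ mul] := Ealg.
apply: (ext (fun x => \sum_l A x j l * B x l k)) => [x|]; first by rewrite mxE.
by apply: subalg_sum => // l; apply: (mul).
Qed.

Lemma adjoint_regularW (u : RSL2 R g -> C) : adjoint_regular g u -> regular u.
Proof.
pose E : (RSL2 R g -> C) -> Prop := @regular R (RSL2 R g).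
have Ealg : subalgebra E by apply: polynomial_in_subalgebra.
have [ext cst _ mul] := Ealg.
apply: polynomial_in_sub (Ealg) _ => -[i [j l]] /=.
have EA a b : E (fun rho => val (rho (g i)) a b).
  exact: polynomial_in_coord (i, (a, b)).
have EB a b : E (fun rho => invmx (val (rho (g i))) a b).
  pose v (rho : RSL2 R g) :=
    (-1) ^+ (a + b) * val (rho (g i)) (rev_ord b) (rev_ord a).
  apply: (ext v) => [rho|]; first by rewrite /v invmx2E ?SL2_det.
  by apply: (mul); first exact: cst.
pose M (rho : RSL2 R g) :=
  pauli R j *m val (rho (g i)) *m pauli R l *m invmx (val (rho (g i))).
apply: (ext (fun rho => 2^-1 * \sum_a M rho a a)) => [rho|].
  by rewrite /sl2_adjoint mxE.
apply: (mul); first exact: cst.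
by apply: subalg_sum => // a; do 3!apply: subalg_mulmx => //.
Qed.

(** Comparison at the generators stands in for equality of points, which would involve their
    morphism structures and liftability proofs. *)
Lemma Rbar_regular_ext (u : Rbar R g -> C) (z z' : Rbar R g) :
  regular u -> (forall i, sval z (g i) = sval z' (g i)) -> u z = u z'.
Proof.
move=> [v [p pE] uE] zz'; rewrite !uE !pE; apply: peval_eq => -[i jk] /=.
by rewrite zz'.
Qed.

Lemma Rbar_regular_adjoint (u : Rbar R g -> C) :
  regular u -> adjoint_regular g (fun rho : RSL2 R g => u (proj_Rbar rho)).
Proof.
move=> [v [p pE] uE]; exists p => rho; rewrite uE pE; apply: peval_eq => -[i jk].
by rewrite /= /proj_hom /= so3_of_psl2E.
Qed.

Lemma adjoint_regular_Rbar (w : RSL2 R g -> C) : adjoint_regular g w ->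
  exists2 u : Rbar R g -> C, regular u & forall rho, u (proj_Rbar rho) = w rho.
Proof.
move=> [p pE].
pose v (rho : RPSL2 R g) :=
  peval p (fun j : 'I_n * ('I_3 * 'I_3) => so3_of_psl2 (rho (g j.1)) j.2.1 j.2.2).
exists (fun z => v (sval z)); first by exists v => //; exists p.
move=> rho; rewrite pE; apply: peval_eq => -[i jk].
by rewrite /= so3_of_psl2E.
Qed.

Lemma Rbar_regular_surj (u v : Rbar R g -> C) : regular u -> regular v ->
  (forall rho, u (proj_Rbar rho) = v (proj_Rbar rho)) -> u =1 v.
Proof.
move=> ureg vreg uv z; have [rho rhoE] := svalP z.
rewrite -(@Rbar_regular_ext u (proj_Rbar rho)) // => [|i]; last exact: rhoE.
by rewrite uv; apply: Rbar_regular_ext => // i; apply: rhoE.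
Qed.

(** Elements of PSL_2(C) and liftable representations both come from SL_2(C), so invariance can be
    tested there. *)
Lemma invariant_proj_Rbar (u : Rbar R g -> C) : regular u ->
  Defs.invariant (@conj_Rbar R Gamma n g) u <->
  Defs.invariant (@conj_RSL2 R Gamma n g)
    (fun rho : RSL2 R g => u (proj_Rbar rho)).
Proof.
move=> ureg.
have conj_proj A (rho : RSL2 R g) : u (proj_Rbar (conj_RSL2 A rho)) =
    u (conj_Rbar (psl2_proj A) (proj_Rbar rho)).
  apply: Rbar_regular_ext => // i.
  by rewrite /= /conj_fun !psl2_projM -psl2_proj_inv.
split=> [uinv A rho|uinv a z]; first by rewrite conj_proj uinv.
have [A ->] := psl2_proj_surj a; have [rho rhoE] := svalP z.
have zE : u z = u (proj_Rbar rho).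
  by apply: Rbar_regular_ext => // i; rewrite /= rhoE.
rewrite zE -(uinv A rho) conj_proj; apply: Rbar_regular_ext => // i.
by rewrite /= /conj_fun /= rhoE.
Qed.

End Rbar.

(* X, Y and Xbar are X(Gamma, SL_2(C)), X(Gamma, SL_2(C))//H^1(Gamma, C_2) and
   the quotient of the liftable representations by PSL_2(C); alpha is the
   induced action of H^1(Gamma, C_2). *)
Theorem proposition4p2 (R : realType) (Gamma : groupType)
    (n : nat) (g : 'I_n -> Gamma) (gP : generates g)
    (X : fspace R) (pX : RSL2 R g -> X)
    (XP : is_quotient (@conj_RSL2 R Gamma n g) pX)
    (alpha : H1C2 Gamma -> X -> X)
    (alphaP : induced_action (@twist_RSL2 R Gamma n g) pX alpha)
    (Y : fspace R) (pY : X -> Y) (YP : is_quotient alpha pY)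
    (Xbar : fspace R) (pbar : Rbar R g -> Xbar)
    (XbarP : is_quotient (@conj_Rbar R Gamma n g) pbar) :
  exists phi : Y -> Xbar,
    isomorphism phi /\
    forall rho : RSL2 R g, phi (pY (pX rho)) = pbar (proj_Rbar rho).
Proof.
have [_ X_pull X_dense X_onto] := XP.
have [Y_aff Y_pull Y_dense Y_onto] := YP.
have [Xbar_aff Xbar_pull Xbar_dense Xbar_onto] := XbarP.
have [alpha_reg alphaE] := alphaP.
apply: (@affine_isomorphism _ _ _ _ (fun rho => pY (pX rho))
  (fun rho : RSL2 R g => pbar (proj_Rbar rho))) => //.
- move=> u v ureg vreg uv; apply: Y_dense => //.
  by apply: X_dense; [case: (Y_pull u) | case: (Y_pull v) |].
- move=> u v ureg vreg uv; apply: Xbar_dense => //.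
  by apply: Rbar_regular_surj => //; [case: (Xbar_pull u) | case: (Xbar_pull v)].
(* From [Y] to [Xbar]: twist invariance lets the pullback descend to [Rbar], and conjugation
   invariance takes it on to [Xbar]. *)
- move=> u ureg; have [uY_reg uY_inv] := Y_pull u ureg.
  have [uX_reg uX_inv] := X_pull _ uY_reg.
  have uX_adj : adjoint_regular g (fun rho => u (pY (pX rho))).
    apply: invariant_adjoint_regular => // eps rho.
    by rewrite -alphaE uY_inv.
  have [w w_reg wE] := adjoint_regular_Rbar uX_adj.
  have [|u' u'_reg u'E] := Xbar_onto w w_reg.
    by apply/invariant_proj_Rbar => // A rho; rewrite !wE uX_inv.
  by exists u' => // rho; rewrite -u'E wE.
- move=> u ureg; have [w_reg w_inv] := Xbar_pull u ureg.
  have w_adj := Rbar_regular_adjoint w_reg.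
  have [|v v_reg vE] := X_onto _ (adjoint_regularW w_adj).
    by apply/(invariant_proj_Rbar w_reg).
  (* Invariance under [alpha] is an equality of regular functions on [X], so it can be checked on
     the image of [pX]. *)
  have v_inv : Defs.invariant alpha v.
    move=> eps; apply: X_dense => // [|rho]; first exact: alpha_reg.
    by rewrite alphaE -!vE (adjoint_regular_twist eps rho w_adj).
  have [u' u'_reg u'E] := Y_onto v v_reg v_inv.
  by exists u' => // rho; rewrite -u'E vE.
Qed.
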